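(* Let $G$ be a finite non-cyclic nilpotent group with distinct Sylow subgroups $G_1,G_2,\dots,G_m$. Then: (i) if at least two of the $G_i$ are non-cyclic, then $\Delta_D(G)^*$ is connected; (ii) if $G_i$ is non-cyclic for exactly one index $i$, then $\Delta_D(G)^*$ is connected if and only if $\Delta_D(G_i)^*$ is connected.
   Context: For a finite group $G$, let $M(G)$ denote its Schur multiplier. A Schur cover of $G$ is a group $\tilde{G}$ with a central extension $\{e\}\to M(G)\xrightarrow{\iota}\tilde{G}\xrightarrow{\pi}G\to\{e\}$ such that $\iota(M(G))\subseteq Z(\tilde{G})\cap[\tilde{G},\tilde{G}]$ and $\tilde G$ has maximal order among such extensions. The deep commuting graph $\Delta_D(G)$ is the simple graph with vertex set $G$ in which two distinct vertices are adjacent if and only if their preimages under $\pi$ commute in $\tilde{G}$. A vertex of a graph $\Gamma$ is dominant if it is adjacent to all other vertices. The reduced graph $\Gamma^*$ is the subgraph of $\Gamma$ induced by the set of non-dominant vertices. *)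

(* Defs.v *)
From mathcomp Require Import all_boot all_fingroup all_solvable.
Set Implicit Arguments. Unset Strict Implicit. Unset Printing Implicit Defensive.
Local Open Scope group_scope.

Definition stem_ext (gT : finGroupType) (G : {group gT})
    (hT : finGroupType) (H : {group hT}) (f : {morphism H >-> gT}) : bool :=
  (f @* H == G) && ('ker f \subset 'Z(H) :&: H^`(1)).

Definition schur_cover (gT : finGroupType) (G : {group gT})
    (hT : finGroupType) (H : {group hT}) (f : {morphism H >-> gT}) : Prop :=
  stem_ext G f /\
  forall (kT : finGroupType) (K : {group kT}) (g : {morphism K >-> gT}),
    stem_ext G g -> #|K| <= #|H|.

Definition deep_adj (gT hT : finGroupType) (H : {group hT})
    (f : {morphism H >-> gT}) (x y : gT) : bool :=
  (x != y) &&
  [forall a in H, [forall b in H,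
     ((f a == x) && (f b == y)) ==> (a * b == b * a)]].

Definition dominant (T : finType) (V : {set T}) (e : rel T) (x : T) : bool :=
  (x \in V) && [forall y in V, (y != x) ==> e x y].

Definition reduced_vertices (T : finType) (V : {set T}) (e : rel T) : {set T} :=
  [set x in V | ~~ dominant V e x].

(* The subgraph induced on V is connected (vacuously so if V is empty). *)
Definition graph_connected (T : finType) (V : {set T}) (e : rel T) : Prop :=
  forall x y, x \in V -> y \in V ->
    connect [rel u v | [&& u \in V, v \in V & e u v]] x y.

Definition deep_reduced_connected (gT : finGroupType) (G : {group gT})
    (hT : finGroupType) (H : {group hT}) (f : {morphism H >-> gT}) : Prop :=
  graph_connected (reduced_vertices G (deep_adj f)) (deep_adj f).

(* Main.v *)
(* For lifts in a stem extension H of G, commuting is decided on the Sylow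
   components, since H is nilpotent.  When two Sylow subgroups are non-cyclic,
   the non-dominant p-elements and p'-elements thus form a complete bipartite
   graph to which every vertex is joined; when only G_p is non-cyclic, the
   p'-part of H is abelian and x |-> x_p is a retraction of the reduced graph of
   G onto that of G_p.
   The Sylow p-subgroup of a Schur cover of G covers G_p, and two facts about
   covers of a p-group P remain: commuting of lifts does not depend on the cover,
   and the cover is non-abelian if P is non-cyclic.  Both follow from the
   existence, for every central extension of P by a p-group with kernel A and
   total group E, of a stem extension of P whose kernel has order at least
   |A :&: E^`(1)|: apply it to the fibre product of two covers, respectively to
   the pullback to P of the extraspecial group p^{1+2}. *)
Require Import Defs.
From mathcomp Require Import all_boot all_fingroup all_solvable zmodp.
Set Implicit Arguments. Unset Strict Implicit. Unset Printing Implicit Defensive.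
Local Open Scope group_scope.

(** * Shrinking central extensions of p-groups to stem extensions *)

Lemma der1_central_supplement (gT : finGroupType) (W U K : {group gT}) :
  K \subset 'Z(W) -> U * K = W -> W^`(1) = U^`(1).
Proof.
rewrite subsetI => /andP[sKW cKW] defW.
have sUW : U \subset W by rewrite -defW mulG_subl.
have cprodW : U \* K = W by rewrite cprodE // (subset_trans cKW) ?centS.
have/derG1P K1 : abelian K by rewrite /abelian (subset_trans cKW) ?centS.
by have /cprodP[_ <- _] := der_cprod 1 cprodW; rewrite K1 mulg1.
Qed.

(** An element [y] of prime order generates a subgroup containing [z], so [<[y]>] lies in [<[z]>].
    Hence ['Ohm_1(X)] lies in [<[z]>] and is cyclic, and it has the same rank as [X]. *)
Lemma pgroup_common_elt_cyclic (p : nat) (gT : finGroupType) (X : {group gT})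
    (z : gT) :
  p.-group X -> abelian X -> z != 1 ->
  (forall Y : {group gT}, Y \subset X -> Y :!=: 1 -> z \in Y) -> cyclic X.
Proof.
move=> pX abX nz1 zY.
rewrite (abelian_rank1_cyclic abX) (rank_pgroup pX) (p_rank_abelian p abX).
rewrite -abelem_cyclic ?Ohm1_abelem //; apply: cyclicS (cycle_cyclic z).
rewrite /= Ohm1Eprime gen_subG; apply/subsetP=> y /setIdP[Xy pr_y].
rewrite -cycle_subG; apply: prime_meetG; first by rewrite -orderE.
apply/trivgPn; exists z => //; rewrite inE cycle_id andbT (zY <[y]>%G) ?cycle_subG //.
by rewrite -cardG_gt1 -orderE prime_gt1.
Qed.

(* Take [N] maximal among the subgroups containing [E^`(1)] but not a given
   [z \in A]: every nontrivial subgroup of [E / N] then contains the image of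
   [z], so [E / N] is cyclic, and [c] is a power of [z]. *)
Lemma cyclic_quotient_meeting (p : nat) (eT : finGroupType) (E A : {group eT}) :
  p.-group E -> A \subset E -> ~~ (A \subset E^`(1)) ->
  exists (N : {group eT}) (t c : eT) (m : nat),
    [/\ [/\ N <| E, E^`(1) \subset N, t \in E & N * <[t]> = E],
        [/\ c \in A, c != 1 & t ^+ m * c^-1 \in N]
      & p.-nat m /\ #|N| * m < #|E|].
Proof.
move=> pE sAE /subsetPn[z Az E'z].
pose gP (N : {group eT}) := [&& E^`(1) \subset N, N \subset E & z \notin N].
have [|N /maxgroupP[/and3P[sE'N sNE Nz] maxN] _] := @maxgroup_exists _ gP E^`(1)%G.
  by rewrite /gP subxx der_sub.
have nsNE := sub_der1_normal sE'N sNE; have nNE := normal_norm nsNE.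
have Ez := subsetP sAE z Az; have NNz := subsetP nNE z Ez.
have ntz : coset N z != 1 by apply: contraNneq Nz => /coset_idr->.
have pX : p.-group (E / N) by apply: quotient_pgroup.
have zY (Y : {group coset_of N}) : Y \subset E / N -> Y :!=: 1 -> coset N z \in Y.
  (* If [Y] missed the image of [z], its preimage would compete with [N] while containing it, hence
     equal [N] by maximality, and [Y] would be trivial. *)
  move=> sYX; apply: contraR => Yz; apply/eqP; rewrite -(cosetpreK Y).
  rewrite (maxN (coset N @*^-1 Y)%G) ?trivg_quotient //=; last exact: sub_cosetpre.
  rewrite /gP (subset_trans sE'N) ?sub_cosetpre //= sub_cosetpre_quo // sYX.
  by apply: contra Yz => /morphpreP[].
have cycX := pgroup_common_elt_cyclic pX (sub_der1_abelian sE'N) ntz zY.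
have ntX : (E / N)%G :!=: 1 by apply/trivgPn; exists (coset N z); rewrite ?mem_quotient.
have [p_pr _ _] := pgroup_pdiv pX ntX.
case/cyclicP: cycX => x defX.
have [t Et defx] : exists2 t, t \in E & x = coset N t.
  have /morphimP[t _ Et ->] : x \in E / N by rewrite defX cycle_id.
  by exists t.
have Nt := subsetP nNE t Et.
have px : p.-elt x by rewrite /p_elt orderE -defX.
have p_x : p %| #[x] by rewrite orderE -defX; case: (pgroup_pdiv pX ntX).
(* With this exponent [x ^+ m] has order [p]; the subgroup it generates contains the image of [z],
   so by primality it lies in [<[coset N z]>], and [c] can be a power of [z]. As [m] is smaller than
   [#[x]], the index of [N], the final strict inequality follows. *)
pose m := #[x] %/ p.
have oxm : #[x ^+ m] = p.
  by rewrite orderXdiv ?dvdn_div // /m divnA // mulKn.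
have /cycleP[j xm] : x ^+ m \in <[coset N z]>.
  rewrite -cycle_subG; apply: prime_meetG; first by rewrite -orderE oxm.
  apply/trivgPn; exists (coset N z) => //; rewrite inE cycle_id andbT.
  apply: (zY <[x ^+ m]>%G); first by rewrite defX cycleX.
  by rewrite -cardG_gt1 -orderE oxm prime_gt1.
exists N, t, (z ^+ j), m; split; first split=> //.
- by rewrite -(quotientGK nsNE) defX defx -quotient_cycle // quotientK ?cycle_subG.
- have xm1 : x ^+ m != 1 by rewrite -order_gt1 oxm prime_gt1.
  split; first by rewrite groupX.
    by apply: contraNneq xm1 => zj1; rewrite xm -morphX // zj1 morph1.
  apply: coset_idr; first by rewrite groupM ?groupV ?groupX.
  by rewrite morphM ?groupV ?groupX // morphV ?groupX // !morphX //= -defx xm mulgV.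
- split; first by apply: pnat_dvd px; rewrite dvdn_div.
- by rewrite -(Lagrange sNE) ltn_pmul2l // -card_quotient // defX ltn_Pdiv ?prime_gt1.
Qed.

Lemma quotient_morphism (gT wT : finGroupType) (W Z : {group wT})
    (f : {morphism W >-> gT}) :
  Z <| W -> Z \subset 'ker f ->
  exists g : {morphism (W / Z) >-> gT},
    [/\ 'ker g = 'ker f / Z, g @* (W / Z) = f @* W
      & {in W, forall x, g (coset Z x) = f x}].
Proof.
move=> nsZW sZf; have nZW := normal_norm nsZW.
have sKf : 'ker (coset Z) \subset 'ker f by rewrite ker_coset.
pose g := factm_morphism sKf nZW.
exists g; split; first by rewrite ker_factm.
  by rewrite (morphim_factm sKf nZW).
by move=> x Wx; rewrite /= factmE.
Qed.

Lemma cyclic_group_of_order (n : nat) :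
  0 < n -> exists (cT : finGroupType) (x : cT), #[x] = n.
Proof. by case: n => // n _; exists 'I_n.+1, Zp1; rewrite order_Zp1. Qed.

Lemma card_join_cycle_leq (gT : finGroupType) (N : {group gT}) (t : gT) (m : nat) :
  t \in 'N(N) -> 0 < m -> t ^+ m \in N -> #|N <*> <[t]>| <= #|N| * m.
Proof.
move=> Nt m_gt0 Ntm.
have nNt : <[t]> \subset 'N(N) by rewrite cycle_subG.
have nsN : N <| N <*> <[t]> by rewrite /normal joing_subl join_subG normG.
rewrite -(Lagrange (normal_sub nsN)) leq_pmul2l // -card_quotient ?normal_norm //.
rewrite quotientYidl // quotient_cycle //= -orderE dvdn_leq //.
by rewrite order_dvdn -morphX //= coset_id.
Qed.

Lemma expg_pair (gT hT : finGroupType) (x : gT) (y : hT) (n : nat) :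
  (x, y) ^+ n = (x ^+ n, y ^+ n).
Proof. by elim: n => // n IH; rewrite !expgS IH. Qed.

(* With [t ^+ m \in N c], replace [t] by [(t, tau)] in the quotient of
   [E * <[tau]>] by [(c, tau ^+ m)]: the new [t] satisfies [t ^+ m \in N], so it
   generates with [N] a group smaller than [E].  Only central elements change, so
   commutators survive; the order of [tau] makes [(c, tau ^+ m)] meet
   [E * 1] trivially. *)
Lemma central_ext_shrink (p : nat) (gT eT : finGroupType) (E : {group eT})
    (f : {morphism E >-> gT}) :
  p.-group E -> 'ker f \subset 'Z(E) -> ~~ ('ker f \subset E^`(1)) ->
  exists (hT : finGroupType) (H : {group hT}) (g : {morphism H >-> gT}),
    [/\ [/\ p.-group H, 'ker g \subset 'Z(H) & g @* H = f @* E],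
        #|'ker f :&: E^`(1)| <= #|'ker g :&: H^`(1)| & #|H| < #|E| ].
Proof.
move=> pE cfE nsfE'; have sfE : 'ker f \subset E by apply: subset_trans (center_sub E).
have [N [t [c [m]]]] := cyclic_quotient_meeting pE sfE nsfE'.
case=> [[nsNE _ Et defE] [kc ntc Ntm] [pm ltNm]].
have m_gt0 : 0 < m by case: m pm {ltNm Ntm}.
have Ec := subsetP sfE c kc; have sNE := normal_sub nsNE.
have pc : p.-nat #[c] by apply: mem_p_elt pE Ec.
have [cT [tau otau]] : exists (cT : finGroupType) (x : cT), #[x] = (m * #[c])%N.
  by apply: cyclic_group_of_order; rewrite muln_gt0 m_gt0 order_gt0.
pose C := <[tau]>%G; pose s := tau ^+ m.
have Ctau : tau \in C by apply: cycle_id.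
have abC : abelian C by apply: cycle_abelian.
have os : #[s] = #[c] by rewrite orderXdiv ?otau ?dvdn_mulr // mulKn.
have Cs : s \in C by apply: groupX.
pose W := setX_group E C.
have pW : p.-group W.
  by rewrite /pgroup cardsX pnatM [p.-nat #|E|]pE /= -orderE otau pnatM pm pc.
have WE (u : eT * cT) : (u \in W) = (u.1 \in E) && (u.2 \in C) by rewrite inE.
have FM : {in W &, {morph (fun u => f u.1) : u v / u * v}}.
  by move=> u v; rewrite !WE => /andP[Eu _] /andP[Ev _]; rewrite morphM.
pose F : {morphism W >-> gT} := Morphism FM.
have kF u : (u \in 'ker F) = (u.1 \in 'ker f) && (u.2 \in C).
  by rewrite !inE -andbA [X in _ && X]andbC andbA.
have cFW : 'ker F \subset 'Z(W).
  apply/subsetP=> [[a i]]; rewrite kF /= => /andP[ka Ci].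
  have /centerP[Ea cEa] := subsetP cfE a ka.
  apply/centerP; split=> [|[b j]]; first by rewrite WE Ea.
  rewrite WE /= => /andP[Eb Cj]; congr (_, _); first exact: cEa.
  exact: (centsP abC).
pose Z := <[(c, s)]>%G.
have sZF : Z \subset 'ker F by rewrite cycle_subG kF kc.
have sZW := subset_trans sZF (subset_trans cFW (center_sub W)).
have nsZW : Z <| W by apply: sub_center_normal (subset_trans sZF cFW).
have nZW := normal_norm nsZW.
have [g [kerg img gE]] := quotient_morphism nsZW sZF.
have cgQ : 'ker g \subset 'Z(W / Z).
  rewrite kerg subsetI quotientS ?quotient_cents //.
    by rewrite (subset_trans cFW) ?subsetIr.
  by rewrite (subset_trans cFW) ?center_sub.
pose N1 := (setX_group N 1 / Z)%G; pose T := coset Z (t, tau).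
have WN : setX N 1 \subset W by rewrite setXS // sub1G.
have Wt : (t, tau) \in W by rewrite WE Et.
pose H := (N1 <*> <[T]>)%G.
have sHQ : H \subset W / Z.
  by rewrite join_subG quotientS // cycle_subG mem_quotient.
(* If [e = n * t ^+ j], then [(e, i)] differs from [(n, 1) * (t, tau) ^+ j] by a factor
   [(1, tau ^- j * i)], which [F] kills. *)
have defQ : H * 'ker g = W / Z.
  apply/eqP; rewrite eqEsubset mul_subG // ?(subset_trans cgQ) ?center_sub //=.
  apply/subsetP=> _ /morphimP[[e i] Ne + ->]; rewrite WE -{1}defE /= => /andP[].
  case/mulsgP=> n _ Nn /cycleP[j ->] def_e Ci.
  have Wn : (n, 1) \in W by rewrite WE (subsetP sNE) /=.
  have Wi : (1, tau ^- j * i) \in W by rewrite WE group1 groupM ?groupV ?groupX.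
  have -> : (e, i) = (n, 1) * ((t, tau) ^+ j * (1, tau ^- j * i)).
    rewrite expg_pair; congr (_, _) => /=; first by rewrite mulg1.
    by rewrite mul1g mulKVg.
  rewrite !morphM ?morphX ?(subsetP nZW) ?groupM ?groupX // mulgA mem_mulg //.
    rewrite groupM ?groupX //; last by rewrite mem_gen // inE cycle_id orbT.
    by rewrite mem_gen // inE mem_quotient // inE Nn group1.
  by rewrite kerg mem_quotient // kF /= group1 groupM ?groupV ?groupX.
have leH : #|H| <= #|N| * m.
  have sN1 : #|N1| <= #|N|.
    apply: leq_trans (leq_quotient _ _) _.
    by rewrite cardsX cards1 muln1.
  apply: leq_trans (leq_mul sN1 (leqnn m)).
  apply: card_join_cycle_leq => //.
    have nN1W : W \subset 'N(setX N 1).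
      apply/subsetP=> [[e i]]; rewrite WE => /andP[Ee _]; rewrite inE.
      apply/subsetP=> _ /imsetP[[n j] + ->]; rewrite !inE => /andP[/= Nn /eqP->].
      by rewrite -/(n ^ e) memJ_norm ?(subsetP (normal_norm nsNE)) // Nn mul1g mulVg /=.
    by apply: (subsetP (quotient_norms Z nN1W)); rewrite mem_quotient.
  have -> : T ^+ m = coset Z (t ^+ m * c^-1, 1).
    rewrite -morphX ?(subsetP nZW) // expg_pair; apply/rcoset_kercosetP.
    - by rewrite (subsetP nZW) // WE !groupX.
    - by rewrite (subsetP nZW) // WE /= (subsetP sNE) /=.
    apply/rcosetP; exists (c, s); first exact: cycle_id.
    congr (_, _) => /=; last by rewrite mulg1.
    by have /centerP[_ /(_ (t ^+ m * c^-1))->] := subsetP cfE c kc; rewrite ?mulgKV ?(subsetP sNE).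
  by rewrite mem_quotient // !inE Ntm /=.
pose h := restrm_morphism sHQ g.
have kerh : 'ker h = H :&: 'ker g by rewrite ker_restrm.
have derQ := der1_central_supplement cgQ defQ.
exists (coset_of Z), H, h; split; first split.
- by apply: pgroupS (sHQ) _; apply: quotient_pgroup.
- rewrite kerh subsetI subsetIl /=; apply: subset_trans (subsetIr _ _) _.
  by apply: subset_trans cgQ _; apply: subset_trans (subsetIr _ _) (centS sHQ).
- rewrite morphim_restrm setIid; transitivity (g @* (W / Z)).
    have <- : g @* (H * 'ker g) = g @* (W / Z) by rewrite defQ.
    by rewrite morphimMl // morphim_ker mulg1.
  rewrite img; apply/setP=> y; apply/morphimP/morphimP=> [[u _ Wu ->]|[x _ Ex ->]].
    by exists u.1 => //; move: Wu; rewrite WE; case/andP.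
  by exists (x, 1) => //; rewrite WE Ex group1.
- rewrite kerh.
  pose phi x := coset Z (x, 1).
  (* Pairs [(x, 1)] and [(y, 1)] with the same image differ by some [(c, s) ^+ j] with [s ^+ j = 1];
     since [s] and [c] have equal orders, [c ^+ j = 1] as well. *)
  have phiI : {in E &, injective phi}.
    move=> x y Ex Ey /kercoset_rcoset[||_ /cycleP[j ->]].
    - by rewrite (subsetP nZW) // WE Ex group1.
    - by rewrite (subsetP nZW) // WE Ey group1.
    rewrite expg_pair => -[-> /esym/eqP].
    by rewrite mulg1 -order_dvdn os order_dvdn => /eqP->; rewrite mul1g.
  rewrite -(card_in_imset (f := phi)); last first.
    by move=> x y /setIP[/(subsetP sfE) Ex _] /setIP[/(subsetP sfE) Ey _]; apply: phiI.
  apply/subset_leq_card/subsetP=> _ /imsetP[x /setIP[kx E'x] ->].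
  have W'x : (x, 1) \in W^`(1).
    have sEW : pairg1 cT @* E \subset W by rewrite morphim_pairg1 setXS ?sub1G.
    apply: (subsetP (dergS 1 sEW)); rewrite -morphim_der ?subsetT //.
    by apply/imsetP; exists x; rewrite // setTI.
  have Q'x : phi x \in H^`(1) by rewrite -derQ -quotient_der ?mem_quotient.
  apply/setIP; split=> //; apply/setIP; split; first exact: (subsetP (der_sub 1 H)).
  rewrite kerg mem_quotient //.
  by rewrite kF kx group1.
- exact: leq_ltn_trans leH ltNm.
Qed.

Lemma stem_ext_of_central_ext (p : nat) (gT eT : finGroupType)
    (G : {group gT}) (E : {group eT}) (f : {morphism E >-> gT}) :
  p.-group E -> 'ker f \subset 'Z(E) -> f @* E = G ->
  exists (kT : finGroupType) (K : {group kT}) (k : {morphism K >-> gT}),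
    stem_ext G k /\ #|G| * #|'ker f :&: E^`(1)| <= #|K|.
Proof.
have [n] := ubnP #|E|; elim: n => // n IH in eT E f *.
rewrite ltnS => leEn pE cfE imf.
have [sfE'|nsfE'] := boolP ('ker f \subset E^`(1)).
  exists eT, E, f; rewrite /stem_ext imf eqxx subsetI cfE sfE'; split=> //.
  rewrite (setIidPl sfE') mulnC -imf card_morphim setIid Lagrange //.
  exact: subset_trans cfE (center_sub E).
have [hT [H [g [[pH cgH img] leD ltH]]]] := central_ext_shrink pE cfE nsfE'.
have [|kT [K [k [stk leK]]]] := IH _ H g (leq_trans ltH leEn) pH cgH.
  by rewrite img.
by exists kT, K, k; split=> //; apply: leq_trans leK; rewrite leq_mul2l leD orbT.
Qed.

(** * Stem extensions of nilpotent groups and of p-groups *)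

Lemma stem_extP (gT hT : finGroupType) (G : {group gT}) (H : {group hT})
    (f : {morphism H >-> gT}) :
  reflect [/\ f @* H = G, 'ker f \subset 'Z(H) & 'ker f \subset H^`(1)]
          (stem_ext G f).
Proof.
by rewrite /stem_ext subsetI; apply: (iffP and3P) => [[/eqP]|[->]]; split.
Qed.

Lemma central_ext_nil (gT hT : finGroupType) (G : {group gT}) (H : {group hT})
    (f : {morphism H >-> gT}) :
  'ker f \subset 'Z(H) -> f @* H = G -> nilpotent G -> nilpotent H.
Proof.
move=> cfH imf nilG; rewrite -quotient_center_nil.
have nsfH := ker_normal f; have nsZH := center_normal H.
have nilHf : nilpotent (H / 'ker f).
  by rewrite (isog_nil (first_isog f)) /= imf.
have /homgP[g img] := homg_quotientS (normal_norm nsfH) (normal_norm nsZH) cfH.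
by rewrite -img morphim_nil.
Qed.

(** The derived subgroup splits along the direct decomposition of [H] into its two Hall cores, and
    the second component of an element of ['O_pi(H)] is trivial. *)
Lemma pcore_dprod_der1 (pi : nat_pred) (hT : finGroupType) (H : {group hT}) (x : hT) :
  nilpotent H -> x \in 'O_pi(H) -> x \in H^`(1) -> x \in 'O_pi(H)^`(1).
Proof.
move=> nilH Ox H'x; have defH := nilpotent_pcoreC pi nilH.
have /dprodP[_ defH' _ _] := der_dprod 1 defH.
move: H'x; rewrite -defH' => /mulsgP[u v O'u O'v def_x].
have Ou := subsetP (der_sub 1 _) u O'u; have Ov := subsetP (der_sub 1 _) v O'v.
suff v1 : v = 1 by rewrite def_x v1 mulg1.
apply/set1P; rewrite -set1gE -(TI_pcoreC pi H H) inE Ov andbT.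
by rewrite -(groupMl _ Ou) -def_x.
Qed.

(** The p'-core [Q] of the nilpotent group [H] has trivial image in [P], so it lies in the kernel:
    it is central, hence abelian, and it is contained in
    [H^](1)[. Its elements then lie in]Q^[(1) = 1]. *)
Lemma stem_ext_pgroup (p : nat) (gT hT : finGroupType) (P : {group gT})
    (H : {group hT}) (f : {morphism H >-> gT}) :
  p.-group P -> stem_ext P f -> p.-group H.
Proof.
move=> pP /stem_extP[imf cfH sfH'].
have nilH := central_ext_nil cfH imf (pgroup_nil pP).
set Q := 'O_p^'(H); have sQH : Q \subset H by apply: pcore_sub.
have sQf : Q \subset 'ker f.
  rewrite ker_trivg_morphim sQH /=.
  have sfQP : f @* Q \subset P by rewrite -imf morphimS.
  rewrite -(setIidPr sfQP) coprime_TIg // (pnat_coprime pP) //.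
  exact: morphim_pgroup (pcore_pgroup _ _).
have /derG1P Q1 : abelian Q.
  by apply: abelianS (subset_trans sQf cfH) (center_abelian H).
have Qtriv : Q = 1.
  apply/trivgP/subsetP=> x Qx; rewrite -Q1; apply: pcore_dprod_der1 => //.
  by rewrite (subsetP sfH') ?(subsetP sQf).
have /dprodP[_ <- _ _] := nilpotent_pcoreC p nilH.
by rewrite -/Q Qtriv mulg1 pcore_pgroup.
Qed.

(** * Fibre products, and independence of commuting from the cover *)

Section FibreProduct.

Variables (gT hT1 hT2 : finGroupType) (H1 : {group hT1}) (H2 : {group hT2}).
Variables (f1 : {morphism H1 >-> gT}) (f2 : {morphism H2 >-> gT}).

Definition fibre_product :=
  [set u : hT1 * hT2 | [&& u.1 \in H1, u.2 \in H2 & f1 u.1 == f2 u.2]].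

Lemma fibre_productP u :
  reflect [/\ u.1 \in H1, u.2 \in H2 & f1 u.1 = f2 u.2] (u \in fibre_product).
Proof. by rewrite inE; apply: (iffP and3P) => [[? ? /eqP]|[? ? /eqP]]. Qed.

Lemma fibre_product_group_set : group_set fibre_product.
Proof.
apply/group_setP; split=> [|u v]; first by rewrite inE !group1 !morph1 /=.
case/fibre_productP=> u1 u2 eq_u /fibre_productP[v1 v2 eq_v].
by rewrite inE !groupM // !morphM // eq_u eq_v /=.
Qed.

Canonical fibre_product_group := Group fibre_product_group_set.

Lemma fibre_product_pgroup p :
  p.-group H1 -> p.-group H2 -> p.-group fibre_product.
Proof.
move=> pH1 pH2; have pW : p.-group (setX H1 H2).
  by rewrite /pgroup cardsX pnatM [p.-nat #|H1|]pH1 [p.-nat #|H2|]pH2.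
by apply: pgroupS pW; apply/subsetP=> u /fibre_productP[u1 u2 _]; rewrite inE u1.
Qed.

Lemma morphim_fst_fibre_product :
  f1 @* H1 \subset f2 @* H2 -> [morphism of fst] @* fibre_product = H1.
Proof.
move=> sim; apply/setP=> x; apply/morphimP/idP=> [[u _ /fibre_productP[? _ _] ->//]|H1x].
have /morphimP[y _ H2y eq_xy] : f1 x \in f2 @* H2 by rewrite (subsetP sim) ?mem_morphim.
by exists (x, y); rewrite ?in_setT //; apply/fibre_productP.
Qed.

Lemma morphim_snd_fibre_product :
  f2 @* H2 \subset f1 @* H1 -> [morphism of snd] @* fibre_product = H2.
Proof.
move=> sim; apply/setP=> y; apply/morphimP/idP=> [[u _ /fibre_productP[_ ? _] ->//]|H2y].
have /morphimP[x _ H1x eq_xy] : f2 y \in f1 @* H1 by rewrite (subsetP sim) ?mem_morphim.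
by exists (x, y); rewrite ?in_setT //; apply/fibre_productP.
Qed.

End FibreProduct.

(* The part [D] of the kernel of the fibre product lying in the derived subgroup
   maps onto ['ker f1], and by maximality of the cover it is no larger; hence a
   commutator of the fibre product is determined by its first component. *)
Lemma schur_cover_commute (p : nat) (gT hT1 hT2 : finGroupType)
    (P : {group gT}) (H1 : {group hT1}) (H2 : {group hT2})
    (f1 : {morphism H1 >-> gT}) (f2 : {morphism H2 >-> gT}) (a1 b1 : hT1)
    (a2 b2 : hT2) :
  p.-group P -> schur_cover P f1 ->
  p.-group H2 -> 'ker f2 \subset 'Z(H2) -> f2 @* H2 = P ->
  a1 \in H1 -> b1 \in H1 -> a2 \in H2 -> b2 \in H2 ->
  f1 a1 = f2 a2 -> f1 b1 = f2 b2 -> commute a1 b1 -> commute a2 b2.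
Proof.
move=> pP [st1 max1] pH2 cf2 im2 Ha1 Hb1 Ha2 Hb2 eqa eqb cab.
have pH1 := stem_ext_pgroup pP st1.
have /stem_extP[im1 cf1 sf1] := st1.
pose E := fibre_product_group f1 f2.
have E1 u : u \in E -> u.1 \in H1 by case/fibre_productP.
have FM : {in E &, {morph (fun u => f1 u.1) : u v / u * v}}.
  by move=> u v /E1 ? /E1 ?; rewrite morphM.
pose F : {morphism E >-> gT} := Morphism FM.
have fstE : [morphism of fst] @* E = H1.
  by apply: morphim_fst_fibre_product; rewrite im1 im2.
have kF u : (u \in 'ker F) = (u \in E) && (f1 u.1 == 1) by rewrite !inE.
have imF : F @* E = P.
  apply/setP=> x; rewrite -im1; apply/morphimP/morphimP=> [[u _ /E1 Hu ->]|[a _ Ha ->]].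
    by exists u.1.
  move: Ha; rewrite -{1}fstE => /morphimP[u _ Eu ->].
  by exists u.
have cFE : 'ker F \subset 'Z(E).
  apply/subsetP=> [[a b]]; rewrite kF => /andP[Eab /= /eqP fa].
  have /fibre_productP[/= Ha Hb fab] := Eab.
  have /centerP[_ cHa] : a \in 'Z(H1) by rewrite (subsetP cf1) //; apply/kerP.
  have /centerP[_ cHb] : b \in 'Z(H2).
    by rewrite (subsetP cf2) //; apply/kerP; rewrite // -fab.
  apply/centerP; split=> // [[c d] /fibre_productP[/= Hc Hd _]].
  congr (_, _); [exact: cHa | exact: cHb].
have [kT [K [k [stk leK]]]] :=
  stem_ext_of_central_ext (fibre_product_pgroup f1 f2 pH1 pH2) cFE imF.
set D := 'ker F :&: E^`(1) in leK.
have leD : #|D| <= #|'ker f1|.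
  have := leq_trans leK (max1 _ _ _ stk).
  rewrite -(Lagrange (subset_trans cf1 (center_sub H1))) [X in _ <= X]mulnC.
  have -> : #|H1 : 'ker f1| = #|P| by rewrite -im1 card_morphim setIid.
  by rewrite leq_pmul2l.
have skerD : 'ker f1 \subset fst @: D.
  apply/subsetP=> x kx; have := subsetP sf1 x kx.
  rewrite -fstE -morphim_der ?subsetT // => /morphimP[u _ E'u def_x].
  apply/imsetP; exists u => //; rewrite inE E'u andbT kF (subsetP (der_sub 1 E)) //=.
  by rewrite -[u.1]def_x (mker kx).
have injD : {in D &, injective fst}.
  apply/imset_injP; rewrite eqn_leq leq_imset_card.
  exact: leq_trans leD (subset_leq_card skerD).
have Eu : (a1, a2) \in E by apply/fibre_productP.
have Ev : (b1, b2) \in E by apply/fibre_productP.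
have E'uv : [~ (a1, a2), (b1, b2)] \in E^`(1) by apply: mem_commg.
have /eqP a1b1 : [~ a1, b1] == 1 by apply/commgP.
have Duv : [~ (a1, a2), (b1, b2)] \in D.
  rewrite inE E'uv andbT kF (subsetP (der_sub 1 E)) //=.
  by rewrite -[X in f1 X]/([~ a1, b1]) a1b1 morph1.
have uv1 : [~ (a1, a2), (b1, b2)] = 1.
  by apply: injD; rewrite ?group1.
by apply/commgP/eqP; rewrite -[LHS]/([~ (a1, a2), (b1, b2)].2) uv1.
Qed.

(** * Covers of non-cyclic p-groups are non-abelian *)

(** The Frattini quotient of a non-cyclic p-group is elementary abelian of rank at least 2; dividing
    it by a subgroup of index [p ^ 2] leaves a copy of [V]. *)
Lemma pgroup_noncyclic_homg (p : nat) (gT hT : finGroupType) (P : {group gT})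
    (V : {group hT}) :
  p.-group P -> ~~ cyclic P -> p.-abelem V -> #|V| = (p ^ 2)%N -> V \homg P.
Proof.
move=> pP ncP abV oV.
have ntP : P :!=: 1 by apply: contraNneq ncP => ->; apply: cyclic1.
have [p_pr _ _] := pgroup_pdiv pP ntP.
have abPhi : p.-abelem (P / 'Phi(P)) := Phi_quotient_abelem pP.
have [pU _ _] := and3P abPhi.
have rU : 2 <= logn p #|P / 'Phi(P)|.
  rewrite ltnNge -abelem_cyclic //.
  by apply: contra ncP; apply: Phi_quotient_cyclic.
have [Q [sQU nsQU oQ]] := normal_pgroup pU (normal_refl _) (leq_subr 2 (logn p #|P / 'Phi(P)|)).
have homQ : (P / 'Phi(P)) / Q \homg P.
  apply: homg_trans (quotient_homg (normal_norm nsQU)) (quotient_homg _).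
  exact: normal_norm (Phi_normal P).
apply: homg_trans homQ; apply: isog_hom; rewrite isog_sym.
rewrite (isog_abelem_card _ (quotient_abelem Q abPhi)) abV oV card_quotient ?normal_norm //.
rewrite -divgS // oQ {1}(card_pgroup pU).
by rewrite -expnB ?leq_subr ?prime_gt0 //= subKn ?eqxx.
Qed.

(** [P] maps onto [S / 'Z(S)], which is elementary abelian of order [p ^ 2]. The pullback [E] of [S]
    along this map still projects onto [S], so [E^](1)[maps onto]S^[(1) = 'Z(S)] and is nontrivial;
    it lies in the kernel because [P] is abelian. *)
Lemma central_ext_noncyclic_abelian (p : nat) (gT : finGroupType)
    (P : {group gT}) :
  p.-group P -> abelian P -> ~~ cyclic P ->
  exists (eT : finGroupType) (E : {group eT}) (f : {morphism E >-> gT}),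
    [/\ p.-group E, 'ker f \subset 'Z(E), f @* E = P
      & 1 < #|'ker f :&: E^`(1)|].
Proof.
move=> pP abP ncP.
have ntP : P :!=: 1 by apply: contraNneq ncP => ->; apply: cyclic1.
have [p_pr _ _] := pgroup_pdiv pP ntP.
pose S := [set: p^{1+2}]%G.
have pS : p.-group S := pX1p2_pgroup p_pr.
have esS : extraspecial S := pX1p2_extraspecial p_pr.
have [[PhiS derS] prZ] := esS.
have oZ : #|'Z(S)| = p := card_center_extraspecial pS esS.
have nZS : S \subset 'N('Z(S)) := normal_norm (center_normal S).
have homV : S / 'Z(S) \homg P.
  apply: pgroup_noncyclic_homg pP ncP _ _.
    by rewrite -PhiS Phi_quotient_abelem.
  rewrite card_quotient // -divgS ?center_sub // oZ card_pX1p2 //.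
  by rewrite expnS mulKn ?prime_gt0.
have /homgP[f1 im1] := homV.
pose f2 := restrm_morphism nZS (coset_morphism 'Z(S)).
have im2 : f2 @* S = S / 'Z(S) by rewrite morphim_restrm setIid.
pose E := fibre_product_group f1 f2.
have fstE : [morphism of fst] @* E = P.
  by apply: morphim_fst_fibre_product; rewrite im1 im2.
have sndE : [morphism of snd] @* E = S.
  by apply: morphim_snd_fibre_product; rewrite im1 im2.
pose F := restrm_morphism (subsetT E) [morphism of fst].
have imF : F @* E = P by rewrite morphim_restrm setIid.
have kF u : (u \in 'ker F) = (u \in E) && (u.1 == 1).
  by rewrite ker_restrm in_setI; congr (_ && _); rewrite !inE.
exists _, E, F; split=> //.
- exact: fibre_product_pgroup.
- apply/subsetP=> [[a b]]; rewrite kF => /andP[Eab /= /eqP a1].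
  have /fibre_productP[/= Ha Hb] := Eab; rewrite a1 morph1 => /esym f2b.
  have /centerP[_ cb] : b \in 'Z(S).
    by apply: coset_idr f2b; rewrite (subsetP nZS).
  apply/centerP; split=> [|[c d] _]; first by rewrite -a1.
  congr (_, _); first by rewrite /= mulg1 mul1g.
  by apply: cb; rewrite inE.
have sE'F : E^`(1) \subset 'ker F.
  rewrite ker_trivg_morphim der_sub /= morphim_der // imF.
  by rewrite (derG1P abP).
rewrite (setIidPr sE'F) cardG_gt1.
apply: contraTneq prZ => E'1; rewrite -derS -{1}sndE -morphim_der ?subsetT // E'1.
by rewrite morphim1 cards1.
Qed.

(** An abelian cover has trivial derived subgroup, hence trivial kernel and order [#|P|]; but then
    [P] is abelian too, and the extraspecial pullback yields a strictly larger stem extension. *)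
Lemma schur_cover_noncyclic_nonabelian (p : nat) (gT hT : finGroupType)
    (P : {group gT}) (H : {group hT}) (f : {morphism H >-> gT}) :
  p.-group P -> ~~ cyclic P -> schur_cover P f -> ~~ abelian H.
Proof.
move=> pP ncP [/stem_extP[imf cf sf'] maxf]; apply/negP=> abH.
have abP : abelian P by rewrite -imf morphim_abelian.
have [eT [E [e [pE cE ime gt1]]]] := central_ext_noncyclic_abelian pP abP ncP.
have [kT [K [k [stk leK]]]] := stem_ext_of_central_ext pE cE ime.
have injf : 'injm f by rewrite (subset_trans sf') // (derG1P abH).
have := leq_trans leK (maxf _ _ _ stk).
rewrite -(card_injm injf) // imf -{2}[#|P|]muln1 leq_pmul2l // leqNgt gt1 //.
Qed.

(** * Hall components of stem extensions and covers *)

Lemma morphim_pcore_nil (pi : nat_pred) (gT hT : finGroupType) (H : {group hT})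
    (f : {morphism H >-> gT}) :
  nilpotent H -> f @* 'O_pi(H) = 'O_pi(f @* H).
Proof.
move=> nilH; apply: nilpotent_Hall_pcore; first exact: morphim_nil.
exact: morphim_pHall (pcore_sub _ _) (nilpotent_pcore_Hall pi nilH).
Qed.

Lemma stem_ext_pcore (pi : nat_pred) (gT hT : finGroupType) (G : {group gT})
    (H : {group hT}) (f : {morphism H >-> gT}) :
  nilpotent G -> stem_ext G f ->
  stem_ext 'O_pi(G) (restrm_morphism (pcore_sub pi H) f).
Proof.
move=> nilG /stem_extP[imf cfH sfH']; have nilH := central_ext_nil cfH imf nilG.
apply/stem_extP; split; rewrite ?ker_restrm.
- by rewrite morphim_restrm setIid -imf morphim_pcore_nil.
- apply/subsetP=> x /setIP[Ox kx]; have /centerP[_ cx] := subsetP cfH x kx.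
  by apply/centerP; split=> // y Oy; apply: cx; rewrite (subsetP (pcore_sub pi H)).
- apply/subsetP=> x /setIP[Ox kx].
  by apply: pcore_dprod_der1; rewrite // (subsetP sfH').
Qed.

(** Stem extensions of the factors combine into one of the whole group, so that the maximality of a
    cover can be tested on one Hall factor at a time. *)
Lemma stem_ext_dprod (gT hT1 hT2 : finGroupType) (G G1 G2 : {group gT})
    (H1 : {group hT1}) (H2 : {group hT2})
    (f1 : {morphism H1 >-> gT}) (f2 : {morphism H2 >-> gT}) :
  G1 \x G2 = G -> stem_ext G1 f1 -> stem_ext G2 f2 ->
  exists f : {morphism setX H1 H2 >-> gT}, stem_ext G f.
Proof.
move=> /dprodP[_ defG cG12 tiG12] /stem_extP[im1 cf1 sf1] /stem_extP[im2 cf2 sf2].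
have G1f a : a \in H1 -> f1 a \in G1 by move=> Ha; rewrite -im1 mem_morphim.
have G2f b : b \in H2 -> f2 b \in G2 by move=> Hb; rewrite -im2 mem_morphim.
have FM : {in setX H1 H2 &, {morph (fun u => f1 u.1 * f2 u.2) : u v / u * v}}.
  move=> [u1 u2] [v1 v2] /setXP[Hu1 Hu2] /setXP[Hv1 Hv2] /=; rewrite !morphM // !mulgA.
  congr (_ * _); rewrite -!mulgA; congr (_ * _).
  by apply/esym/(centsP cG12); rewrite ?G1f ?G2f.
pose F := Morphism FM; exists F.
(* A trivial product of values in [G1] and [G2] puts both values in the trivial intersection, so the
   kernel splits componentwise. *)
have kF u : u \in 'ker F -> u.1 \in 'ker f1 /\ u.2 \in 'ker f2.
  case: u => a b ku; have /setXP[Ha Hb] := dom_ker ku; have /eqP := mker ku.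
  rewrite /= -eq_invg_mul => /eqP def2.
  have a1 : f1 a = 1.
    apply/set1P; rewrite -set1gE -tiG12 inE G1f //=.
    by rewrite -groupV def2 G2f.
  by split; apply/kerP; rewrite // -def2 a1 invg1.
have sX1 : setX H1 1 \subset setX H1 H2 by rewrite setXS ?sub1G.
have sX2 : setX 1 H2 \subset setX H1 H2 by rewrite setXS ?sub1G.
apply/stem_extP; split.
- rewrite -defG; apply/setP=> x; apply/morphimP/mulsgP=> [[[a b] _ /setXP[Ha Hb] ->]|].
    by exists (f1 a) (f2 b); rewrite ?G1f ?G2f.
  case=> y z; rewrite -im1 -im2 => /morphimP[a _ Ha ->] /morphimP[b _ Hb ->] ->.
  by exists (a, b); rewrite // in_setX Ha.
- apply/subsetP=> [[a b]] /kF[/= ka kb].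
  have /centerP[Ha ca] := subsetP cf1 a ka; have /centerP[Hb cb] := subsetP cf2 b kb.
  apply/centerP; split=> [|[c d] /setXP[/= Hc Hd]]; first by rewrite in_setX Ha.
  by congr (_, _); [exact: ca | exact: cb].
- apply/subsetP=> [[a b]] /kF[/= ka kb].
  have -> : (a, b) = pairg1 hT2 a * @pair1g hT1 hT2 b.
    by congr (_, _); rewrite /= ?mulg1 ?mul1g.
  apply: groupM.
    have sD : pairg1 hT2 @* H1 \subset setX_group H1 H2 by rewrite morphim_pairg1.
    apply: (subsetP (dergS 1 sD)); rewrite -morphim_der ?subsetT //.
    by rewrite mem_morphim ?in_setT ?(subsetP sf1).
  have sD : @pair1g hT1 hT2 @* H2 \subset setX_group H1 H2 by rewrite morphim_pair1g.
  apply: (subsetP (dergS 1 sD)); rewrite -morphim_der ?subsetT //.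
  by rewrite mem_morphim ?in_setT ?(subsetP sf2).
Qed.

(** Given a stem extension [K] of ['O_pi(G)], its product with ['O_pi^'(H)] is a stem extension of
    [G]. Maximality of [H] bounds its order, and the common factor [#|'O_pi^'(H)|] cancels. *)
Lemma schur_cover_pcore (pi : nat_pred) (gT hT : finGroupType) (G : {group gT})
    (H : {group hT}) (f : {morphism H >-> gT}) :
  nilpotent G -> schur_cover G f ->
  schur_cover 'O_pi(G) (restrm_morphism (pcore_sub pi H) f).
Proof.
move=> nilG [stf maxf]; split=> [|kT K g stg]; first exact: stem_ext_pcore.
have /stem_extP[imf cfH _] := stf; have nilH := central_ext_nil cfH imf nilG.
have [F stF] := stem_ext_dprod (nilpotent_pcoreC pi nilG) stg
  (stem_ext_pcore pi^' nilG stf).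
have := maxf _ (setX_group _ _) F stF.
by rewrite cardsX -(dprod_card (nilpotent_pcoreC pi nilH)) leq_pmul2r.
Qed.

(** * Commuting of lifts and its Hall components *)

(** Adjacency freed from the distinctness clause: distinct elements may have equal p-parts, so only
    this reflexive version passes to components. *)
Definition lifts_commute (gT hT : finGroupType) (H : {group hT})
    (f : {morphism H >-> gT}) (x y : gT) : bool :=
  [forall a in H, [forall b in H,
     ((f a == x) && (f b == y)) ==> (a * b == b * a)]].

Lemma deep_adjE (gT hT : finGroupType) (H : {group hT})
    (f : {morphism H >-> gT}) (x y : gT) :
  deep_adj f x y = (x != y) && lifts_commute f x y.
Proof. by []. Qed.

Section LiftsCommute.

Variables (gT hT : finGroupType) (G : {group gT}) (H : {group hT}).
Variable f : {morphism H >-> gT}.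
Hypotheses (cfH : 'ker f \subset 'Z(H)) (imf : f @* H = G).

(** Lifts of one element differ by a kernel element, which is central, so a single pair of lifts
    decides. *)
Lemma lifts_commuteP a b :
  a \in H -> b \in H -> reflect (commute a b) (lifts_commute f (f a) (f b)).
Proof.
move=> Ha Hb; apply: (iffP idP) => [/forall_inP/(_ a Ha)/forall_inP/(_ b Hb)|cab].
  by rewrite !eqxx => /eqP.
apply/forall_inP=> c Hc; apply/forall_inP=> d Hd; apply/implyP=> /andP[/eqP fc /eqP fd].
have cz z u : z \in 'ker f -> u \in H -> commute z u.
  by move=> kz Hu; have /centerP[_] := subsetP cfH z kz; apply.
have [k kk ->] : exists2 k, k \in 'ker f & c = k * a.
  by apply/rcosetP/rcoset_kerP.
have [l kl ->] : exists2 l, l \in 'ker f & d = l * b.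
  by apply/rcosetP/rcoset_kerP.
have Hk := dom_ker kk; have Hl := dom_ker kl.
apply/eqP; apply: commuteM; last apply: commute_sym; last apply: commuteM.
- by apply: commute_sym; apply: cz => //; rewrite groupM.
- by apply: commute_sym; apply: cz.
- by apply: commute_sym.
Qed.

Lemma lift_exists x : x \in G -> exists2 a, a \in H & x = f a.
Proof. by rewrite -imf => /morphimP[a _ Ha ->]; exists a. Qed.

Lemma lifts_commute_refl x : x \in G -> lifts_commute f x x.
Proof. by case/lift_exists=> a Ha ->; apply/lifts_commuteP. Qed.

Lemma lifts_commute_sym x y : x \in G -> y \in G ->
  lifts_commute f x y = lifts_commute f y x.
Proof.
case/lift_exists=> a Ha -> /lift_exists[b Hb ->].
by apply/lifts_commuteP/lifts_commuteP=> // /commute_sym.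
Qed.

Lemma reduced_verticesP x :
  reflect (x \in G /\ exists2 y, y \in G & ~~ lifts_commute f x y)
          (x \in reduced_vertices G (deep_adj f)).
Proof.
rewrite inE /dominant; case Gx: (x \in G) => /=; last by constructor; case.
apply: (iffP idP) => [/forall_inPn[y Gy]|[_ [y Gy ncxy]]].
  rewrite negb_imply deep_adjE => /andP[nyx]; rewrite eq_sym nyx /=.
  by split=> //; exists y.
apply/forall_inPn; exists y => //; rewrite negb_imply deep_adjE (negPf ncxy) andbF andbT.
by apply: contraNneq ncxy => ->; apply: lifts_commute_refl.
Qed.

Lemma connect_lifts_commute (V : {set gT}) x y :
  x \in V -> y \in V -> lifts_commute f x y ->
  connect [rel u v | [&& u \in V, v \in V & deep_adj f u v]] x y.
Proof.
move=> Vx Vy cxy; have [->|nxy] := eqVneq x y; first exact: connect0.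
by apply: connect1; rewrite /= Vx Vy deep_adjE nxy.
Qed.

Hypothesis nilH : nilpotent H.

(** Constituents are powers, which gives one direction. For the other, a pi-element and a
    pi'-element of the nilpotent group [H] always commute, so only the two matching pairs of
    constituents matter. *)
Lemma lifts_commute_constt (pi : nat_pred) x y : x \in G -> y \in G ->
  lifts_commute f x y =
    lifts_commute f x.`_pi y.`_pi && lifts_commute f x.`_pi^' y.`_pi^'.
Proof.
case/lift_exists=> a Ha -> /lift_exists[b Hb ->].
have Hc z rho : z \in H -> z.`_rho \in H by move=> Hz; rewrite groupX.
rewrite -!morph_constt //; apply/lifts_commuteP/andP=> // [cab|[]].
  have cc rho : commute a.`_rho b.`_rho by apply: commuteX2.
  by split; apply/lifts_commuteP; rewrite ?Hc.
move=> /lifts_commuteP-/(_ (Hc _ _ Ha) (Hc _ _ Hb)) c1.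
move=> /lifts_commuteP-/(_ (Hc _ _ Ha) (Hc _ _ Hb)) c2.
have cross rho u v : u \in H -> v \in H -> commute u.`_rho v.`_rho^'.
  move=> Hu Hv; have cuv : coprime #|<[u.`_rho]>| #|<[v.`_rho^']>|.
    exact: pnat_coprime (p_elt_constt rho u) (p_elt_constt rho^' v).
  have sC z eta : z \in H -> <[z.`_eta]> \subset H by move=> Hz; rewrite cycle_subG Hc.
  have cvu := sub_nilpotent_cent2 nilH (sC u rho Hu) (sC v rho^' Hv) cuv.
  by apply: commute_sym; apply: (centsP cvu); apply: cycle_id.
rewrite -(consttC pi a) -(consttC pi b).
have c12 := cross pi a b Ha Hb; have c21 := commute_sym (cross pi b a Hb Ha).
by apply: commuteM; apply: commute_sym; apply: commuteM; apply: commute_sym.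
Qed.

End LiftsCommute.

Lemma lifts_commute1 (gT hT : finGroupType) (G : {group gT}) (H : {group hT})
    (f : {morphism H >-> gT}) (x : gT) :
  'ker f \subset 'Z(H) -> f @* H = G -> x \in G -> lifts_commute f x 1.
Proof.
move=> cfH imf /(lift_exists imf)[a Ha ->]; rewrite -(morph1 f).
by apply/(lifts_commuteP cfH) => //; rewrite /commute mulg1 mul1g.
Qed.

Lemma lifts_commute_pcore (pi : nat_pred) (gT hT : finGroupType)
    (G : {group gT}) (H : {group hT}) (f : {morphism H >-> gT}) (x y : gT) :
  nilpotent G -> stem_ext G f -> x \in 'O_pi(G) -> y \in 'O_pi(G) ->
  lifts_commute (restrm_morphism (pcore_sub pi H) f) x y = lifts_commute f x y.
Proof.
move=> nilG stf; have /stem_extP[imf cfH _] := stf.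
have /stem_extP[img cg _] := stem_ext_pcore pi nilG stf.
case/(lift_exists img)=> a Oa -> /(lift_exists img)[b Ob ->].
have sOH := subsetP (pcore_sub pi H).
by apply/(lifts_commuteP cg)/(lifts_commuteP cfH); rewrite ?sOH.
Qed.

Lemma schur_cover_lifts_commute (p : nat) (gT hT1 hT2 : finGroupType)
    (P : {group gT}) (H1 : {group hT1}) (H2 : {group hT2})
    (f1 : {morphism H1 >-> gT}) (f2 : {morphism H2 >-> gT}) (x y : gT) :
  p.-group P -> schur_cover P f1 -> schur_cover P f2 -> x \in P -> y \in P ->
  lifts_commute f1 x y = lifts_commute f2 x y.
Proof.
move=> pP cov1 cov2 Px Py; have [st1 _] := cov1; have [st2 _] := cov2.
have /stem_extP[im1 cf1 _] := st1; have /stem_extP[im2 cf2 _] := st2.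
have pH1 := stem_ext_pgroup pP st1; have pH2 := stem_ext_pgroup pP st2.
have [a1 Ha1 xa1] := lift_exists im1 Px; have [b1 Hb1 yb1] := lift_exists im1 Py.
have [a2 Ha2 xa2] := lift_exists im2 Px; have [b2 Hb2 yb2] := lift_exists im2 Py.
rewrite {1}xa1 {1}yb1 xa2 yb2.
apply/(lifts_commuteP cf1 Ha1 Hb1)/(lifts_commuteP cf2 Ha2 Hb2) => cab.
  by apply: (schur_cover_commute pP cov1 pH2 cf2 im2 Ha1 Hb1) cab; rewrite -?xa1 -?yb1.
by apply: (schur_cover_commute pP cov2 pH1 cf1 im1 Ha2 Hb2) cab; rewrite -?xa2 -?yb2.
Qed.

(** The p-core of [H] covers ['O_p(G)] and is non-abelian; images of two non-commuting elements
    serve. This is the source of non-dominant p-elements. *)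
Lemma noncyclic_pcore_noncommuting (p : nat) (gT hT : finGroupType)
    (G : {group gT}) (H : {group hT}) (f : {morphism H >-> gT}) :
  nilpotent G -> schur_cover G f -> ~~ cyclic 'O_p(G) ->
  exists x y, [/\ x \in 'O_p(G), y \in 'O_p(G) & ~~ lifts_commute f x y].
Proof.
move=> nilG cov ncP; have [stf _] := cov; have /stem_extP[imf cfH _] := stf.
have covP := schur_cover_pcore p nilG cov.
have := schur_cover_noncyclic_nonabelian (pcore_pgroup p G) ncP covP.
case/subsetPn=> a Oa; rewrite -sub_cent1 => /subsetPn[b Ob ncab].
have sOH := subsetP (pcore_sub p H).
have Of c : c \in 'O_p(H) -> f c \in 'O_p(G).
  move=> Oc; rewrite -imf -(morphim_pcore_nil p f (central_ext_nil cfH imf nilG)).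
  by rewrite mem_morphim ?sOH.
exists (f a), (f b); split; try exact: Of.
apply: contra ncab => /(lifts_commuteP cfH (sOH a Oa) (sOH b Ob)) cab.
by apply/cent1P; exact: commute_sym.
Qed.

(** * Connectedness of the reduced graph *)

Lemma connect_map (S T : finType) (e : rel S) (e' : rel T) (h : S -> T) :
  (forall u v, e u v -> connect e' (h u) (h v)) ->
  forall x y, connect e x y -> connect e' (h x) (h y).
Proof.
move=> he x _ /connectP[s es ->]; elim: s x es => [|z s IH] x /=; first by rewrite connect0.
by case/andP=> /he exz /IH; apply: connect_trans.
Qed.

(** A nilpotent group with cyclic Sylow subgroups is cyclic; a Sylow p-subgroup of the p'-core is
    trivial, and the others lie in Sylow subgroups of [G]. *)
Lemma cyclic_pcore_compl (p : nat) (gT : finGroupType) (G : {group gT}) :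
  nilpotent G ->
  (forall (q : nat) (Q : {group gT}),
     prime q -> q != p -> Q \in 'Syl_q(G) -> cyclic Q) ->
  cyclic 'O_p^'(G).
Proof.
move=> nilG cycS; apply: nil_Zgroup_cyclic; last exact: nilpotentS (pcore_sub _ _) nilG.
apply/forall_inP=> V /SylowP[q q_pr sylV].
have sVG : V \subset G := subset_trans (pHall_sub sylV) (pcore_sub _ _).
have [q_p | nqp] := eqVneq q p.
  suff -> : V :=: 1 by apply: cyclic1.
  rewrite -(setIidPl (pHall_sub sylV)) coprime_TIg //.
  by apply: pnat_coprime (pHall_pgroup sylV) _; rewrite q_p; apply: pcore_pgroup.
have [Q sylQ sVQ] := Sylow_superset sVG (pHall_pgroup sylV).
by apply: cyclicS sVQ (cycS q Q _ _ _); rewrite ?inE.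
Qed.

(** ['O_pi(H)] is cyclic modulo a central subgroup, hence abelian. *)
Lemma pcore_compl_lifts_commute (pi : nat_pred) (gT hT : finGroupType)
    (G : {group gT}) (H : {group hT}) (f : {morphism H >-> gT}) (x y : gT) :
  nilpotent G -> stem_ext G f -> cyclic 'O_pi(G) ->
  x \in 'O_pi(G) -> y \in 'O_pi(G) -> lifts_commute f x y.
Proof.
move=> nilG stf cycO Ox Oy; rewrite -(lifts_commute_pcore nilG stf Ox Oy).
have /stem_extP[img cg _] := stem_ext_pcore pi nilG stf.
set g := restrm_morphism _ f in img cg *.
have abO : abelian 'O_pi(H).
  apply: cyclic_factor_abelian cg _.
  by rewrite (isog_cyclic (first_isog g)) /= img.
have [a Oa ->] := lift_exists img Ox; have [b Ob ->] := lift_exists img Oy.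
by apply/(lifts_commuteP cg) => //; apply: (centsP abO).
Qed.

Lemma deep_reduced_connected_two_noncyclic (p q : nat) (gT hT : finGroupType)
    (G : {group gT}) (H : {group hT}) (f : {morphism H >-> gT}) :
  nilpotent G -> schur_cover G f -> p != q ->
  ~~ cyclic 'O_p(G) -> ~~ cyclic 'O_q(G) -> deep_reduced_connected G f.
Proof.
move=> nilG cov nepq ncp ncq; have [/stem_extP[imf cfH _] _] := cov.
have nilH := central_ext_nil cfH imf nilG.
have sOG rho := subsetP (pcore_sub rho G).
have Gc x rho : x \in G -> x.`_rho \in G by move=> Gx; rewrite groupX.
have cross u v : u \in G -> v \in G -> p.-elt u -> p^'.-elt v -> lifts_commute f u v.
  move=> Gu Gv pu pv; rewrite (lifts_commute_constt cfH imf nilH p) //.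
  have -> : v.`_p = 1 by apply/constt1P.
  have -> : u.`_p^' = 1 by apply/constt1P; rewrite p_eltNK.
  rewrite [X in _ && X](lifts_commute_sym cfH imf) ?group1 ?Gc //.
  by rewrite !(lifts_commute1 cfH imf) ?Gc.
rewrite /deep_reduced_connected; set V := reduced_vertices G (deep_adj f).
have VP x : reflect (x \in G /\ exists2 y, y \in G & ~~ lifts_commute f x y) (x \in V).
  exact: (reduced_verticesP cfH imf).
have inV x y : x \in G -> y \in G -> ~~ lifts_commute f x y -> x \in V.
  by move=> Gx Gy ncxy; apply/VP; split=> //; exists y.
have sVG x : x \in V -> x \in G by case/VP.
clearbody V.
have wit (r : nat) : ~~ cyclic 'O_r(G) -> exists z, z \in V /\ z \in 'O_r(G).
  move=> ncr; have [a [b [Oa Ob ncab]]] := noncyclic_pcore_noncommuting nilG cov ncr.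
  by exists a; split; first by apply: inV ncab; apply: (sOG r).
have [zp [Vzp Ozp]] := wit p ncp; have [zq [Vzq Ozq]] := wit q ncq.
have pzp : p.-elt zp := mem_p_elt (pcore_pgroup p G) Ozp.
have p'zq : p^'.-elt zq.
  apply: sub_in_pnat (mem_p_elt (pcore_pgroup q G) Ozq) => r _ /eqnP->.
  by rewrite !inE eq_sym.
pose e := [rel u v | [&& u \in V, v \in V & deep_adj f u v]].
have e_sym : connect_sym e.
  apply: sym_connect_sym => u v /=; rewrite andbCA.
  case Vu: (u \in V); case Vv: (v \in V) => //=; rewrite !deep_adjE eq_sym.
  by rewrite (lifts_commute_sym cfH imf) ?sVG.
have link u v : u \in V -> v \in V -> lifts_commute f u v -> connect e u v.
  exact: connect_lifts_commute.
(* Failure to commute with some [y] shows on the p-parts or on the p'-parts, so [x.]_p[or]x.[_p^']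
   is again a vertex. The p'-part is joined directly to [zp]; the p-part reaches it through [zq]. *)
have to_zp x : x \in V -> connect e x zp.
  move=> Vx; have /VP[Gx [y Gy]] := Vx.
  rewrite (lifts_commute_constt cfH imf nilH p) // negb_and.
  have cxc rho : lifts_commute f x x.`_rho.
    have [a Ha ->] := lift_exists imf Gx; rewrite -morph_constt //.
    by apply/(lifts_commuteP cfH); rewrite ?groupX //; apply: commuteX.
  case/orP=> ncxy.
    have Vxp : x.`_p \in V by apply: inV ncxy; apply: Gc.
    apply: connect_trans (link _ _ Vx Vxp (cxc p)) _.
    apply: (@connect_trans _ _ zq).
      by apply: link => //; apply: cross; rewrite ?sVG ?p_elt_constt.
    by rewrite e_sym; apply: link => //; apply: cross; rewrite ?sVG.
  have Vxp : x.`_p^' \in V by apply: inV ncxy; apply: Gc.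
  apply: connect_trans (link _ _ Vx Vxp (cxc p^')) _.
  by rewrite e_sym; apply: link => //; apply: cross; rewrite ?sVG ?p_elt_constt.
move=> x y Vx Vy; apply: connect_trans (to_zp x Vx) _.
by rewrite -/e e_sym to_zp.
Qed.

Lemma deep_reduced_connected_one_noncyclic (p : nat) (gT hT kT : finGroupType)
    (G : {group gT}) (H : {group hT}) (K : {group kT})
    (f : {morphism H >-> gT}) (g : {morphism K >-> gT}) :
  nilpotent G -> schur_cover G f -> schur_cover 'O_p(G) g ->
  cyclic 'O_p^'(G) ->
  deep_reduced_connected G f <-> deep_reduced_connected 'O_p(G) g.
Proof.
move=> nilG cov covg cycp'; have [stf _] := cov; have [stg _] := covg.
have /stem_extP[imf cfH _] := stf; have /stem_extP[img cgK _] := stg.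
have nilH := central_ext_nil cfH imf nilG.
have nilHall rho := nilpotent_pcore_Hall rho nilG.
have Oc rho x : x \in G -> x.`_rho \in 'O_rho(G).
  by move=> Gx; rewrite (mem_Hall_pcore (nilHall rho)) ?groupX // p_elt_constt.
have sOG rho := subsetP (pcore_sub rho G).
have pO x : x \in 'O_p(G) -> x.`_p = x.
  by move=> Ox; apply: constt_p_elt; apply: mem_p_elt (pcore_pgroup p G) Ox.
have comO x y : x \in 'O_p(G) -> y \in 'O_p(G) ->
    lifts_commute f x y = lifts_commute g x y.
  move=> Ox Oy; rewrite -(lifts_commute_pcore nilG stf Ox Oy).
  exact: schur_cover_lifts_commute (pcore_pgroup p G) (schur_cover_pcore p nilG cov) covg Ox Oy.
(* The p'-parts always have commuting lifts, so only the p-parts count. *)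
have comG x y : x \in G -> y \in G ->
    lifts_commute f x y = lifts_commute g x.`_p y.`_p.
  move=> Gx Gy; rewrite (lifts_commute_constt cfH imf nilH p) // comO ?Oc //.
  by rewrite (pcore_compl_lifts_commute nilG stf cycp') ?Oc // andbT.
rewrite /deep_reduced_connected.
set VG := reduced_vertices G (deep_adj f).
set VP := reduced_vertices 'O_p(G) (deep_adj g).
have VGE x : x \in G -> (x \in VG) = (x.`_p \in VP).
  move=> Gx; apply/(reduced_verticesP cfH imf)/(reduced_verticesP cgK img).
    case=> _ [y Gy]; rewrite comG // => ncxy.
    by split; first exact: Oc; exists y.`_p; rewrite ?Oc.
  case=> _ [y Oy ncxy]; have Gy := sOG p y Oy.
  by split=> //; exists y; rewrite // comG // (pO y).
have sVG x : x \in VG -> x \in G by case/setIdP.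
have sVP x : x \in VP -> x \in 'O_p(G) by case/setIdP.
have VPG x : x \in VP -> x \in VG.
  by move=> Vx; have Ox := sVP x Vx; rewrite VGE ?pO // (sOG p).
(* Taking p-parts sends a path of [VG] to one of [VP], where an edge may collapse to a point, and it
   fixes the end points, which are p-elements. *)
split=> conn x y Vx Vy.
  rewrite -(pO x (sVP x Vx)) -(pO y (sVP y Vy)).
  apply: (connect_map (h := fun z => z.`_p) _ (conn x y (VPG x Vx) (VPG y Vy))) => u v /and3P[Vu Vv /andP[_ cuv]].
  have [Gu Gv] := (sVG u Vu, sVG v Vv).
  apply: connect_lifts_commute; [by rewrite -VGE | by rewrite -VGE | by rewrite -comG].
(* Conversely, each vertex [z] is adjacent or equal to its p-part, and a path of [VP] between
   p-parts is also a path of [VG]. *)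
have toP z : z \in VG -> lifts_commute f z z.`_p.
  move=> Vz; have Gz := sVG z Vz; rewrite comG ?groupX // (pO _ (Oc p z Gz)).
  by apply: (lifts_commute_refl cgK img); apply: Oc.
have VpP z : z \in VG -> z.`_p \in VP by move=> Vz; rewrite -VGE ?sVG.
have VpG z (Vz : z \in VG) := VPG _ (VpP z Vz).
apply: connect_trans (connect_lifts_commute Vx (VpG x Vx) (toP x Vx)) _.
apply: connect_trans (connect_lifts_commute (VpG y Vy) Vy _); last first.
  by rewrite (lifts_commute_sym cfH imf) ?sVG ?VpG ?toP.
apply: (connect_map (h := id) _ (conn _ _ (VpP x Vx) (VpP y Vy))) => u v.
case/and3P=> Vu Vv /andP[_ cuv].
by apply: connect_lifts_commute; rewrite ?VPG // comO ?sVP.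
Qed.

Theorem theorem3p12 (gT : finGroupType) (G : {group gT})
    (hT : finGroupType) (Gt : {group hT}) (pi : {morphism Gt >-> gT}) :
  nilpotent G -> ~~ cyclic G -> schur_cover G pi ->
  ((exists (p q : nat) (P Q : {group gT}),
      [/\ prime p, prime q, p != q, P \in 'Syl_p(G) & Q \in 'Syl_q(G)]
      /\ ~~ cyclic P /\ ~~ cyclic Q) ->
   deep_reduced_connected G pi)
  /\
  (forall (p : nat) (P : {group gT})
          (kT : finGroupType) (Pt : {group kT}) (rho : {morphism Pt >-> gT}),
      prime p -> P \in 'Syl_p(G) -> ~~ cyclic P ->
      (forall (q : nat) (Q : {group gT}),
          prime q -> q != p -> Q \in 'Syl_q(G) -> cyclic Q) ->
      schur_cover P rho ->
      (deep_reduced_connected G pi <-> deep_reduced_connected P rho)).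
Proof.
move=> nilG _ cov.
(* Nilpotency makes each Sylow subgroup a core, which reduces both claims to statements about
   ['O_p(G)]. *)
have SylE r (R : {group gT}) : R \in 'Syl_r(G) -> R = 'O_r(G)%G.
  by rewrite inE => sylR; apply: val_inj; apply: nilpotent_Hall_pcore.
split=> [[p [q [P [Q [[_ _ nepq /SylE-> /SylE->] [ncp ncq]]]]]]|].
  exact: deep_reduced_connected_two_noncyclic nepq ncp ncq.
move=> p P kT Pt rho _ /SylE-> _ cycS covP.
exact: deep_reduced_connected_one_noncyclic covP (cyclic_pcore_compl nilG cycS).
Qed.
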